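(* $\mathrm{ex}(n,\{\text{bat},\text{nested},\text{ears}\})\in\Theta(n^2)$.
   Context: Let $P$ be a set of $n$ points in convex position in the plane (the vertices of a convex $n$-gon); a triangle on $P$ is a 3-element subset of $P$. For two distinct triangles $t_1,t_2$ on $P$, label each point of $t_1\cup t_2$ by the triangle(s) containing it and read the points in their cyclic order around the polygon. The pair forms exactly one of eight configurations. (i) If $t_1,t_2$ share two vertices $u,v$: ''taco'' if their third vertices lie on the same side of the line $uv$, ''mariposa'' if on opposite sides. (ii) If they share exactly one vertex $v$: read the remaining four vertices in cyclic order starting just after $v$; ''bat'' if the pattern is $t_1t_1t_2t_2$ or $t_2t_2t_1t_1$, ''nested'' if it is $t_1t_2t_2t_1$ or $t_2t_1t_1t_2$, ''crossing'' if it is $t_1t_2t_1t_2$ or $t_2t_1t_2t_1$. (iii) If they share no vertex, the cyclic sequence of the six labels is, up to rotation, reflection and exchanging the roles of $t_1,t_2$, one of: ''ears'' $AAABBB$, ''swords'' $AABABB$, ''david'' $ABABAB$. For a set $X$ of configurations, $\mathrm{ex}(n,X)$ is the maximum size of a family of triangles on $P$ in which no two triangles form a configuration belonging to $X$ (this depends only on $n$ and $X$). *)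

(* Defs.v *)
From HB Require Import structures.
From mathcomp Require Export all_boot all_order all_algebra finmap.
From mathcomp Require Export boolp reals.

Set Implicit Arguments.
Unset Strict Implicit.
Unset Printing Implicit Defensive.

Import Order.TTheory GRing.Theory Num.Theory.
Local Open Scope fset_scope.
Local Open Scope ring_scope.

Section Plane.
Variable R : realType.

Definition in_convex_hull (A : {fset R * R}) (x : R * R) : Prop :=
  exists w : R * R -> R,
    [/\ forall q, q \in A -> 0 <= w q,
        \sum_(q <- A) w q = 1,
        \sum_(q <- A) w q * q.1 = x.1 &
        \sum_(q <- A) w q * q.2 = x.2].

Definition convex_position (P : {fset R * R}) : Prop :=
  forall x, x \in P -> ~ in_convex_hull (P `\ x) x.

(* Twice the signed area of the triangle abc: positive iff a, b, c is a
   counterclockwise turn; as a function of c, its sign tells the side of the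
   line ab on which c lies. *)
Definition orient (a b c : R * R) : R :=
  (b.1 - a.1) * (c.2 - a.2) - (b.2 - a.2) * (c.1 - a.1).

(* When the points of s are in convex position and s has at least three
   elements, this says that s is the counterclockwise cyclic order of its points
   around the polygon, read from an arbitrary starting point. *)
Definition ccw_listing (s : seq (R * R)) : Prop :=
  uniq s /\
  forall i j k, (i < j < k)%N -> (k < size s)%N -> 0 < orient s`_i s`_j s`_k.

End Plane.

Inductive config :=
  Taco | Mariposa | Bat | Nested | Crossing | Ears | Swords | David.

(* Two-letter words are boolean sequences; w is w0 up to rotation, reflection and
   exchange of the two letters. *)
Definition same_pattern (w w0 : seq bool) : Prop :=
  exists k, let u := rot k w0 in
    w \in [:: u; rev u; map negb u; map negb (rev u)].

Section Triangles.
Variables (R : realType) (P : {fset R * R}).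
Implicit Types (t : {set P}) (s : seq P).

Definition reading t1 t2 s : Prop :=
  s =i t1 :|: t2 /\ ccw_listing (map val s).

Definition labels t s : seq bool := [seq x \in t | x <- s].

Definition share_two (side : R -> Prop) t1 t2 : Prop :=
  exists u v a b : P,
    [/\ u != v, t1 :&: t2 = [set u; v]%SET,
        t1 :\: t2 = [set a]%SET, t2 :\: t1 = [set b]%SET &
        side (orient (val u) (val v) (val a) * orient (val u) (val v) (val b))].

Definition share_one (w : seq bool) t1 t2 : Prop :=
  exists (v : P) (s : seq P),
    [/\ t1 :&: t2 = [set v]%SET, reading t1 t2 (v :: s) &
        labels t1 s = w \/ labels t2 s = w].

Definition share_none (w : seq bool) t1 t2 : Prop :=
  t1 :&: t2 = set0 /\
  exists s, reading t1 t2 s /\ same_pattern (labels t1 s) w.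

Definition forms (c : config) t1 t2 : Prop :=
  match c with
  | Taco     => share_two (fun x => 0 < x) t1 t2
  | Mariposa => share_two (fun x => x < 0) t1 t2
  | Bat      => share_one [:: true; true; false; false] t1 t2
  | Nested   => share_one [:: true; false; false; true] t1 t2
  | Crossing => share_one [:: true; false; true; false] t1 t2
  | Ears     => share_none [:: true; true; true; false; false; false] t1 t2
  | Swords   => share_none [:: true; true; false; true; false; false] t1 t2
  | David    => share_none [:: true; false; true; false; true; false] t1 t2
  end.

Definition avoiding (X : config -> Prop) (F : {set {set P}}) : Prop :=
  (forall t, t \in F -> #|t| = 3%N) /\
  (forall t1 t2, t1 \in F -> t2 \in F -> t1 != t2 ->
     forall c, X c -> ~ forms c t1 t2).

Definition ex_triangles (X : config -> Prop) : nat :=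
  \max_(F : {set {set P}} | `[< avoiding X F >]) #|F|.

End Triangles.

Definition bat_nested_ears (c : config) : Prop :=
  c = Bat \/ c = Nested \/ c = Ears.

(* Main.v *)
Require Import Defs.
From mathcomp Require Import all_boot all_order all_algebra finmap.
From mathcomp Require Import boolp reals.
From mathcomp Require Import zify ring lra.

(** Sorting a set in convex position by angle around its lexicographically least
    point lists it in counterclockwise order.

    Upper bound: let [i < j < k] be a triangle of a family without nested pairs.
    If the family also contains [i < j < k'] with [k < k'] and [i < j' < k] with
    [j < j'], then those two triangles are nested. Hence [k] is the largest third
    vertex for [(i, j)] or [j] is the largest middle vertex for [(i, k)], which
    leaves at most [2 n^2] triangles.

    Lower bound: with [m = n %/ 3], take the [m^2] triangles [{i, m + i, 2 m + j}],
    [i, j < m]. The chords [(i, m + i)] cross pairwise, whereas in a bat, a nested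
    pair or ears no chord of private vertices of one triangle separates two
    private vertices of the other. *)

Set Implicit Arguments.
Unset Strict Implicit.
Unset Printing Implicit Defensive.

Import Order.TTheory GRing.Theory Num.Theory.
Local Open Scope ring_scope.

(** * Convex position and the counterclockwise order of its points *)

Section Orientation.
Variable R : realType.
Implicit Types (a b c p : R * R) (P : {fset R * R}).

Lemma orient_rot a b c : orient b c a = orient a b c.
Proof. by rewrite /orient; ring. Qed.

Lemma orient_swap a b c : orient b a c = - orient a b c.
Proof. by rewrite /orient; ring. Qed.

(** The hull weights are sums of weighted indicators, so [a], [b], [c] may coincide; a segment is
    thus handled as a degenerate triangle. *)
Lemma convex_position_barycenter P p a b c (wa wb wc : R) :
    convex_position P -> p \in P ->
    a \in (P `\ p)%fset -> b \in (P `\ p)%fset -> c \in (P `\ p)%fset ->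
    0 <= wa -> 0 <= wb -> 0 <= wc -> wa + wb + wc = 1 ->
    p.1 = wa * a.1 + wb * b.1 + wc * c.1 ->
    p.2 = wa * a.2 + wb * b.2 + wc * c.2 -> False.
Proof.
move=> cP pP aP bP cP' wa0 wb0 wc0 w1 p1 p2; apply: (cP p pP).
exists (fun q => wa * (q == a)%:R + wb * (q == b)%:R + wc * (q == c)%:R).
have pick (g : R * R -> R) (u : R) z : z \in (P `\ p)%fset ->
    \sum_(q <- (P `\ p)%fset) u * (q == z)%:R * g q = u * g z.
  move=> zP; rewrite (bigD1_seq z) //= eqxx mulr1 big1 ?addr0 // => q /negPf->.
  by rewrite mulr0 mul0r.
have picks (g : R * R -> R) : \sum_(q <- (P `\ p)%fset)
    (wa * (q == a)%:R + wb * (q == b)%:R + wc * (q == c)%:R) * g q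
    = wa * g a + wb * g b + wc * g c.
  under eq_bigr do rewrite !mulrDl.
  by rewrite !big_split /= !pick.
split; last 2 first.
- by rewrite picks.
- by rewrite picks.
- by move=> q _; rewrite !addr_ge0 // mulr_ge0 // ler0n.
- by rewrite -[LHS]mulr1 mulr_suml (picks (fun=> 1)) !mulr1.
Qed.

Definition lexi_lt (a b : R * R) : bool :=
  (a.1 < b.1) || (a.1 == b.1) && (a.2 < b.2).

(** Both points are lexicographically beyond [p], so if aligned with [p] they lie on one ray from
    it, and the nearer one is a convex combination of [p] and the farther one. *)
Lemma convex_position_not_aligned P p a b : convex_position P ->
  p \in P -> a \in P -> b \in P -> lexi_lt p a -> lexi_lt p b -> a != b ->
  orient p a b != 0.
Proof.
move=> cP pP aP bP pa pb ab; apply/eqP => o0.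
have between u v (l m : R) : u \in P -> v \in P -> u != v -> p != u ->
    0 <= l -> l <= m -> 0 < m ->
    m * (u.1 - p.1) = l * (v.1 - p.1) -> m * (u.2 - p.2) = l * (v.2 - p.2) ->
    False.
  move=> uP vP uv pu l0 lm m0 e1 e2.
  have e z : l / m * z = (l * z) / m by rewrite mulrAC.
  have mn0 : m != 0 by rewrite gt_eqF.
  have lm1 : l / m <= 1 by rewrite ler_pdivrMr ?mul1r.
  have lm0 : 0 <= l / m by rewrite divr_ge0 // ltW.
  apply: (@convex_position_barycenter P u p v v (1 - l / m) (l / m) 0) => //;
    rewrite ?in_fsetD1 ?pP ?vP ?pu ?(eq_sym v) ?uv //.
  - lra.
  - lra.
  - have := e (v.1 - p.1); rewrite -e1 [m * _]mulrC mulfK //; lra.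
  - have := e (v.2 - p.2); rewrite -e2 [m * _]mulrC mulfK //; lra.
have ne q : lexi_lt p q -> p != q.
  by apply: contraTneq => ->; rewrite /lexi_lt !ltxx andbF.
have pna := ne _ pa; have pnb := ne _ pb; have ba : b != a by rewrite eq_sym.
move: o0 pa pb; rewrite /orient /lexi_lt => o0.
(* The ratio of distances to [p] is read on abscissas, or on ordinates when the ray is vertical;
   exactly one vertical direction contradicts alignment. *)
case/orP=> [pa|/andP[/eqP pa pa']] /orP[pb|/andP[/eqP pb pb']].
- case: (lerP a.1 b.1) => [le_ab|lt_ba].
    by apply: (between a b (a.1 - p.1) (b.1 - p.1)) => //; lra.
  by apply: (between b a (b.1 - p.1) (a.1 - p.1)) => //; lra.
- by rewrite -pb subrr mulr0 subr0 in o0; nra.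
- by rewrite -pa subrr mul0r sub0r in o0; nra.
- case: (lerP a.2 b.2) => [le_ab|lt_ba].
    by apply: (between a b (a.2 - p.2) (b.2 - p.2)) => //; nra.
  by apply: (between b a (b.2 - p.2) (a.2 - p.2)) => //; nra.
Qed.

(** Seen from [p], the three directions have angles in a half-open interval of length pi, where the
    sign of [orient p] compares angles. *)
Lemma orient_trans p a b c : lexi_lt p a -> lexi_lt p b -> lexi_lt p c ->
  0 <= orient p a b -> 0 <= orient p b c -> 0 <= orient p a c.
Proof.
have half q : lexi_lt p q -> 0 <= q.1 - p.1 /\ (q.1 = p.1 -> 0 < q.2 - p.2).
  rewrite /lexi_lt => /orP[h|/andP[/eqP h h']]; first by split; lra.
  by split; lra.
move=> /half[a1 a2] /half[b1 b2] /half[c1 c2]; rewrite /orient => ab bc.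
have [b0|b0] := eqVneq b.1 p.1.
  have := b2 b0 => b2'; have c0 : c.1 = p.1 by rewrite b0 subrr in bc; nra.
  have := c2 c0 => c2'; rewrite c0 subrr mulr0 subr0; nra.
have {b0}b0 : 0 < b.1 - p.1 by rewrite lt_neqAle b1 eq_sym subr_eq0 b0.
(* [(b.1 - p.1) * orient p a c] equals [(c.1 - p.1) * orient p a b + (a.1 - p.1) * orient p b c]. *)
rewrite -(pmulr_rge0 _ b0).
have := mulr_ge0 ab c1; have := mulr_ge0 bc a1; lra.
Qed.

(* If [b] were not beyond the chord [ac], the areas would be its nonnegative
   barycentric coordinates in the triangle [pac]. *)
Lemma convex_position_fan P p a b c : convex_position P ->
  p \in P -> a \in P -> b \in P -> c \in P -> p != b -> a != b -> c != b ->
  0 < orient p a b -> 0 < orient p b c -> 0 < orient p a c ->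
  0 < orient a b c.
Proof.
move=> cP pP aP bP cP' pb ab cb oab obc oac; rewrite ltNge; apply/negP => oabc.
set D := orient p a c in oac; have D0 : D != 0 by rewrite gt_eqF.
apply: (@convex_position_barycenter P b p a c (- orient a b c / D)
  (orient p b c / D) (orient p a b / D)) => //;
  rewrite ?in_fsetD1 ?pb ?ab ?cb ?pP ?aP //.
- by rewrite divr_ge0 ?oppr_ge0 ?(ltW oac).
- by rewrite divr_ge0 ?ltW.
- by rewrite divr_ge0 ?ltW.
- by move: D0; rewrite /D /orient => D0; field.
- by move: D0; rewrite /D /orient => D0; field.
- by move: D0; rewrite /D /orient => D0; field.
Qed.

Lemma lexi_min_exists P (x0 : P) :
  exists p : P, forall q : P, q != p -> lexi_lt (val p) (val q).
Proof.
have [p _ pmin] :=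
  @arg_minP _ (R *l R)%type P x0 predT (fun q => val q) isT.
exists p => q; rewrite -(inj_eq val_inj); have := pmin q isT.
case: (val p) (val q) => [p1 p2] [q1 q2]; rewrite lexi_pair /lexi_lt /= xpair_eqE.
by case: ltgtP => //= _; case: ltgtP.
Qed.

Lemma convex_position_ccw_enum P (x0 : P) : convex_position P ->
  exists f : nat -> P,
  [/\ forall i j, (i < #|` P|)%N -> (j < #|` P|)%N -> f i = f j -> i = j,
      forall x : P, exists2 i, (i < #|` P|)%N & f i = x &
      forall i j k, (i < j < k)%N -> (k < #|` P|)%N ->
        0 < orient (val (f i)) (val (f j)) (val (f k))].
Proof.
move=> cP; have [p pmin] := lexi_min_exists x0.
pose r (a b : P) := 0 <= orient (val p) (val a) (val b).
pose s := sort r [seq q <- enum {: P} | q != p].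
have us : uniq s by rewrite sort_uniq filter_uniq // enum_uniq.
have memE x : (x \in s) = (x != p) by rewrite mem_sort mem_filter mem_enum andbT.
have sort_s : pairwise r s.
  (* Transitivity of [r] is available only away from [p], which is in relation with every point in
     both directions; hence the restriction to [s]. *)
  rewrite -(@sorted_pairwise_in _ (mem s)) ?all_mem //.
  - apply: sort_sorted => a b; rewrite /r.
    have -> : orient (val p) (val b) (val a) = - orient (val p) (val a) (val b).
      by rewrite -orient_rot orient_swap orient_rot.
    by rewrite oppr_ge0 le_total.
  - move=> b a c bs as_ cs; apply: orient_trans; apply: pmin; rewrite -memE.
    + exact: as_.
    + exact: bs.
    + exact: cs.
have size_s : (size s).+1 = #|` P|.
  rewrite size_sort size_filter cardfE cardE -(count_predC (pred1 p)) addnC.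
  by rewrite count_uniq_mem ?enum_uniq // mem_enum addn1.
have ups : uniq (p :: s) by rewrite /= memE eqxx us.
exists (nth p (p :: s)); rewrite -size_s; split.
- by move=> i j li lj /eqP; rewrite nth_uniq // => /eqP.
- move=> x; exists (index x (p :: s)); last first.
    by apply: nth_index; rewrite inE memE orbN.
  by rewrite -[(size s).+1]/(size (p :: s)) index_mem inE memE orbN.
have fan j k : (j < k)%N -> (k < size s)%N ->
    0 < orient (val p) (val (nth p s j)) (val (nth p s k)).
  move=> jk ks; have js := ltn_trans jk ks.
  have rjk : r (nth p s j) (nth p s k) by apply: (pairwiseP p sort_s).
  rewrite lt_neqAle eq_sym [X in _ && X]rjk andbT.
  apply: (convex_position_not_aligned cP); do ?exact: fsvalP.
  - by apply: pmin; rewrite -memE mem_nth.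
  - by apply: pmin; rewrite -memE mem_nth.
  - by rewrite (inj_eq val_inj) nth_uniq // neq_ltn jk.
(* Index 0 is [p]: triples containing it are the fan, all others follow from three fan triangles. *)
move=> i j [|k]; first by rewrite ltn0 andbF.
case: i j => [|i] [|j] //; rewrite !ltnS /=; first exact: fan.
move=> /andP[ij jk] ks; have js := ltn_trans jk ks; have is_ := ltn_trans ij js.
apply: (@convex_position_fan P (val p)); do ?exact: fsvalP; rewrite ?(inj_eq val_inj) //.
- by rewrite eq_sym -memE mem_nth.
- by rewrite nth_uniq // neq_ltn ij.
- by rewrite nth_uniq // neq_ltn jk orbT.
- exact: fan.
- exact: fan.
- by apply: fan => //; apply: ltn_trans jk.
Qed.
End Orientation.

(** * Cyclic words and separation by chords *)

(* Whether the indices [i], [j], [k] occur in this order up to rotation. *)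
Definition cyclic3 i j k := (i < j)%N (+) (j < k)%N (+) (i < k)%N.

(* The true letters of the cyclic word [w] are not separated by its false letters,
   so that no chord between true letters crosses one between false letters. *)
Definition split_word (w : seq bool) :=
  let I := iota 0 (size w) in
  all (fun i => all (fun j => all (fun k => all (fun l =>
    [&& nth false w i, nth false w j, ~~ nth false w k, ~~ nth false w l & i != j]
      ==> (cyclic3 i j k == cyclic3 i j l)) I) I) I) I.

(** Rotations by six or more leave the word unchanged, so finitely many words remain, each checked
    by computation. *)
Lemma split_word_rot w :
  same_pattern w [:: true; true; true; false; false; false] -> split_word w.
Proof.
case=> k /=; case: (ltnP k 6) => [|k6]; last first.
  by rewrite rot_oversize // !inE => /or4P[] /eqP->; vm_compute.
by case: k => [|[|[|[|[|[|k]]]]]] // _; rewrite !inE => /or4P[] /eqP->; vm_compute.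
Qed.

(** Permuting three points multiplies [orient] by the signature, and for distinct indices [cyclic3]
    singles out the even permutations of the increasing order. *)
Lemma ccw_listing_orient (R : realType) (s : seq (R * R)) i j k :
  ccw_listing s -> (i < size s)%N -> (j < size s)%N -> (k < size s)%N ->
  i != j -> j != k -> i != k ->
  (0 < (-1) ^+ (~~ cyclic3 i j k) * orient s`_i s`_j s`_k).
Proof.
move=> [_ ccw] li lj lk; rewrite /cyclic3.
case: (ltngtP i j) => // ij _; case: (ltngtP j k) => // jk _;
  case: (ltngtP i k) => // ik _; try lia;
  rewrite /= ?expr0 ?expr1 ?mul1r ?mulN1r.
- by apply: ccw => //; lia.
- by rewrite -orient_swap -orient_rot; apply: ccw => //; lia.
- by rewrite orient_rot; apply: ccw => //; lia.
- by rewrite -orient_swap; apply: ccw => //; lia.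
- by rewrite -orient_rot; apply: ccw => //; lia.
- by rewrite -orient_swap orient_rot; apply: ccw => //; lia.
Qed.

(** [split_word] gives both orientations the same sign, which is squared in their product. *)
Lemma split_word_same_side (R : realType) (P : {fset R * R}) (t : {set P})
    (s : seq P) (x x' y y' : P) :
  ccw_listing (map val s) -> split_word (labels t s) ->
  x \in s -> x' \in s -> y \in s -> y' \in s ->
  x \in t -> x' \in t -> y \notin t -> y' \notin t -> x != x' ->
  0 < orient (val x) (val x') (val y) * orient (val x) (val x') (val y').
Proof.
move=> ccw sw xs x's ys y's xt x't yt y't xx'.
have lab z : z \in s -> nth false (labels t s) (index z s) = (z \in t).
  by move=> zs; rewrite (nth_map z) ?index_mem // nth_index.
have io z : z \in s -> index z s \in iota 0 (size (labels t s)).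
  by move=> zs; rewrite mem_iota /= size_map index_mem.
have ne z z' : z \in s -> z' \in s -> z != z' -> index z s != index z' s.
  move=> zs z's; apply: contra_neq => e.
  by have := nth_index z zs; rewrite e nth_index.
have lt z : z \in s -> (index z s < size (map val s))%N.
  by move=> zs; rewrite size_map index_mem.
have V z : z \in s -> (map val s)`_(index z s) = val z.
  by move=> zs; rewrite (nth_map z) ?index_mem // nth_index.
have ny z z' : z \in t -> z' \notin t -> z != z'.
  by move=> zt; apply: contraNneq => <-.
move: sw => /allP/(_ _ (io _ xs)) /allP/(_ _ (io _ x's)).
move=> /allP/(_ _ (io _ ys)) /allP/(_ _ (io _ y's)).
rewrite !lab // xt x't yt y't ne //= => /eqP e.
have O z (zs : z \in s) (zt : z \notin t) := ccw_listing_orient ccw (lt _ xs)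
  (lt _ x's) (lt _ zs) (ne _ _ xs x's xx') (ne _ _ x's zs (ny _ _ x't zt))
  (ne _ _ xs zs (ny _ _ xt zt)).
have := mulr_gt0 (O _ ys yt) (O _ y's y't).
by rewrite e mulrACA -expr2 sqrr_sign mul1r !V.
Qed.

(** * Triangles as increasing triples of indices *)

Section CcwEnumeration.
Variables (R : realType) (P : {fset R * R}) (f : nat -> P).
Let n := #|` P|.
Hypothesis f_inj : forall i j, (i < n)%N -> (j < n)%N -> f i = f j -> i = j.
Hypothesis f_surj : forall x : P, exists2 i, (i < n)%N & f i = x.
Hypothesis f_ccw : forall i j k, (i < j < k)%N -> (k < n)%N ->
  0 < orient (val (f i)) (val (f j)) (val (f k)).

Definition tri i j k : {set P} := [set f i; f j; f k]%SET.

Lemma eq_f i j : (i < n)%N -> (j < n)%N -> (f i == f j) = (i == j).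
Proof. by move=> li lj; apply/eqP/eqP => [|->//]; apply: f_inj. Qed.

Lemma in_tri i j k m : (i < n)%N -> (j < n)%N -> (k < n)%N -> (m < n)%N ->
  (f m \in tri i j k) = [|| m == i, m == j | m == k].
Proof. by move=> li lj lk lm; rewrite !inE !eq_f // orbA. Qed.

Lemma card3_tri (t : {set P}) : #|t| = 3%N ->
  exists i j k, [/\ (i < j < k)%N, (k < n)%N & t = tri i j k].
Proof.
move=> t3.
have [x xt] : exists x, x \in t by apply/card_gt0P; rewrite t3.
have t2 : #|t :\ x|%SET = 2 by move: (cardsD1 x t); rewrite xt t3; lia.
have /cards2P[y [z [yz tE]]] : #|t :\ x|%SET == 2 by rewrite t2.
have {tE}tE : t = [set x; y; z]%SET by rewrite -(setD1K xt) tE setUA.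
have xy : x != y by apply/eqP => xy; move: t3; rewrite tE xy setUid cards2 yz.
have xz : x != z.
  by apply/eqP => xz; move: t3; rewrite tE xz setUAC setUid cards2 eq_sym yz.
have [a la ax] := f_surj x; have [b lb by_] := f_surj y.
have [c lc cz] := f_surj z; subst x y z.
rewrite !eq_f // in yz xy xz.
have h i j k : (i < j < k)%N -> (k < n)%N -> t =i [set f i; f j; f k]%SET ->
    exists i j k, [/\ (i < j < k)%N, (k < n)%N & t = tri i j k].
  by move=> ijk lk e; exists i, j, k; split=> //; apply/setP.
have tE' u : (u \in t) = [|| u == f a, u == f b | u == f c].
  by rewrite tE !inE orbA.
case: (ltngtP a b) xy => // ab _; case: (ltngtP b c) yz => // bc _;
  case: (ltngtP a c) xz => // ac _; try lia;
  [apply: (h a b c)|apply: (h a c b)|apply: (h c a b)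
  |apply: (h b a c)|apply: (h b c a)|apply: (h c b a)]; try lia;
  move=> u; rewrite tE' !inE; do ![case: (_ == _)] => //.
Qed.

(** * The quadratic upper bound *)

Lemma nested_tri i j j' k k' :
  (i < j)%N -> (j < j')%N -> (j' < k)%N -> (k < k')%N -> (k' < n)%N ->
  forms Nested (tri i j k') (tri i j' k).
Proof.
move=> ij jj' j'k kk' lk'.
have E m : (m < n)%N ->
   (f m \in tri i j k' = [|| m == i, m == j | m == k'])
 * (f m \in tri i j' k = [|| m == i, m == j' | m == k]).
  by move=> lm; rewrite !in_tri //; lia.
exists (f i), [:: f j; f j'; f k; f k']; split.
- apply/setP => x; have [m lm <-] := f_surj x.
  by rewrite inE !E // in_set1 eq_f //; lia.
- split.
    move=> x; have [m lm <-] := f_surj x.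
    by rewrite in_setU !E // !in_cons in_nil !eq_f //; lia.
  split.
    rewrite map_inj_uniq; last exact: val_inj.
    by rewrite /= !inE !eq_f //; lia.
  move=> [|[|[|[|[|a]]]]] [|[|[|[|[|b]]]]] [|[|[|[|[|c]]]]] //= abc lc;
    by [apply: f_ccw; lia | exfalso; lia].
- by left; rewrite /labels /= !E //; do 4?[congr (_ :: _)]; lia.
Qed.

Lemma avoiding_upper (F : {set {set P}}) : avoiding bat_nested_ears F -> (#|F| <= 2 * n ^ 2)%N.
Proof.
move=> [F3 Fav].
pose T := [set x : 'I_n * 'I_n * 'I_n |
  (x.1.1 < x.1.2 < x.2)%N && (tri x.1.1 x.1.2 x.2 \in F)]%SET.
have FT : (#|F| <= #|T|)%N.
  pose g (x : 'I_n * 'I_n * 'I_n) := tri x.1.1 x.1.2 x.2.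
  rewrite (leq_trans _ (leq_imset_card g T)) //.
  apply/subset_leq_card/subsetP => t tF.
  have [i [j [k [ijk lk e]]]] := card3_tri (F3 _ tF).
  have li : (i < n)%N by lia.
  have lj : (j < n)%N by lia.
  apply/imsetP; exists (Ordinal li, Ordinal lj, Ordinal lk) => //.
  by rewrite inE /= ijk -e.
pose A := [set x in T | [forall y in T, (y.1 == x.1) ==> (y.2 <= x.2)%N]]%SET.
pose B := [set x in T |
  [forall y in T, ((y.1.1 == x.1.1) && (y.2 == x.2)) ==> (y.1.2 <= x.1.2)%N]]%SET.
have TAB : T \subset A :|: B.
  apply/subsetP => x xT; rewrite in_setU [x \in A]in_set [x \in B]in_set xT /=.
  apply/orP; case: (boolP [forall _ in _, _]) => [|nA]; [by left | right].
  move: nA; rewrite negb_forall_in => /exists_inP[y yT].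
  rewrite negb_imply -ltnNge => /andP[/eqP y1 y2].
  apply/forall_inP => z zT; apply/implyP => /andP[/eqP z1 /eqP z2].
  rewrite leqNgt; apply/negP => z3.
  (* Here [x] is [(i, j, k)], [y] raises its third vertex to [k'] and [z] raises its middle vertex
     to [j']; the triangles of [y] and [z] are nested. *)
  case: x y z xT yT zT y1 y2 z1 z2 z3 => [[i j] k] [[? ?] k'] [[? j'] ?] /=.
  rewrite !in_set /= => /andP[ijk _] /andP[ijk' tF] /andP[ij'k t'F] [? ?] kk' ? ? jj'.
  subst; apply: (Fav _ _ tF t'F _ Nested); [|by right; left|].
    apply/eqP => /setP/(_ (f j)).
    by rewrite !in_tri ?ltn_ord // eqxx orbT => /esym; lia.
  by apply: nested_tri => //; lia.
have cA : (#|A| <= n ^ 2)%N.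
  (* Two elements of [A] with the same first pair bound each other's third index, so the projection
     is injective on [A]; likewise for [B] with the outer pair. *)
  rewrite -(@card_in_imset _ _ (fun x : 'I_n * 'I_n * 'I_n => x.1) A).
    by rewrite (leq_trans (max_card _)) // card_prod !card_ord mulnn.
  move=> x y; rewrite ![_ \in A]in_set.
  move=> /andP[xT /forall_inP xm] /andP[yT /forall_inP ym] /= e.
  have := xm _ yT; have := ym _ xT; rewrite e eqxx /= => h1 h2.
  case: x y e h1 h2 {xT yT xm ym} => [x1 x2] [y1 y2] /= -> h1 h2.
  by congr (_, _); apply: val_inj => /=; lia.
have cB : (#|B| <= n ^ 2)%N.
  rewrite -(@card_in_imset _ _ (fun x : 'I_n * 'I_n * 'I_n => (x.1.1, x.2)) B).
    by rewrite (leq_trans (max_card _)) // card_prod !card_ord mulnn.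
  move=> x y; rewrite ![_ \in B]in_set.
  move=> /andP[xT /forall_inP xm] /andP[yT /forall_inP ym] /= [e1 e2].
  have := xm _ yT; have := ym _ xT; rewrite e1 e2 !eqxx /= => h1 h2.
  case: x y e1 e2 h1 h2 {xT yT xm ym} => [[x1 x2] x3] [[y1 y2] y3] /= -> -> h1 h2.
  by congr (_, _, _); apply: val_inj => /=; lia.
have := subset_leq_card TAB; have [+ _] := leq_card_setU A B; lia.
Qed.


(** * The quadratic lower bound *)

(** The endpoints interleave: [i < i' < m + i < m + i'], or the same with [i] and [i'] exchanged. *)
Lemma crossing_chords m i i' : (2 * m <= n)%N -> (i < m)%N -> (i' < m)%N ->
  i != i' ->
  orient (val (f i)) (val (f (m + i))) (val (f i')) *
  orient (val (f i)) (val (f (m + i))) (val (f (m + i'))) < 0.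
Proof.
move=> mn im i'm; case: ltngtP => // ii' _.
  have : 0 < orient (val (f i)) (val (f i')) (val (f (m + i))).
    by apply: f_ccw; lia.
  rewrite -oppr_lt0 -orient_swap -orient_rot => o1.
  by rewrite nmulr_rlt0 // f_ccw //; lia.
have : 0 < orient (val (f i)) (val (f (m + i'))) (val (f (m + i))).
  by apply: f_ccw; lia.
rewrite -oppr_lt0 -orient_swap -orient_rot => o1.
by rewrite nmulr_llt0 // orient_rot f_ccw //; lia.
Qed.

Definition chord_family m : {set {set P}} :=
  [set tri ij.1 (m + ij.1) (2 * m + ij.2) | ij : 'I_m * 'I_m]%SET.

Lemma chord_familyP m t : (3 * m <= n)%N -> t \in chord_family m ->
  exists i j, [/\ (i < m)%N, (j < m)%N & forall l, (l < n)%N ->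
    (f l \in t) = [|| l == i, l == m + i | l == 2 * m + j]%N].
Proof.
move=> mn /imsetP[[i j] _ ->] /=; exists i, j; split=> // l ln.
by have := ltn_ord i; have := ltn_ord j => jm im; rewrite in_tri //; lia.
Qed.

(** The three vertices lie in disjoint blocks of [m] indices, so a triangle determines both
    parameters. *)
Lemma card_chord_family m : (3 * m <= n)%N -> #|chord_family m| = (m ^ 2)%N.
Proof.
move=> mn; rewrite card_imset ?card_prod ?card_ord ?mulnn //.
move=> [i j] [i' j'] /= /setP e.
have := ltn_ord i; have := ltn_ord j; have := ltn_ord i'; have := ltn_ord j'.
move=> lj' li' lj li.
have := e (f i); rewrite !in_tri ?eqxx /=; try lia; move=> /esym ei.
have := e (f (2 * m + j)); rewrite !in_tri ?eqxx ?orbT /=; try lia; move=> /esym ej.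
by congr (_, _); apply: val_inj => /=; lia.
Qed.

Lemma chord_family_avoiding m : (3 * m <= n)%N ->
  avoiding bat_nested_ears (chord_family m).
Proof.
move=> mn; split.
  move=> _ /imsetP[[i j] _ ->] /=.
  have := ltn_ord i; have := ltn_ord j => jm im.
  by rewrite /tri setUC cardsU1 cards2 !inE !eq_f //; lia.
move=> t1 t2 /(chord_familyP mn)[i [j [im jm E1]]].
move=> /(chord_familyP mn)[i' [j' [i'm j'm E2]]] t12 c Xc cfg.
(* With equal chords the triangles share two vertices, while the forbidden configurations share at
   most one. *)
have [ii'|ii'] := eqVneq i i'.
  subst i'.
  have in12 l : l = i \/ l = (m + i)%N -> f l \in (t1 :&: t2)%SET.
    by move=> le; rewrite in_setI E1 ?E2; lia.
  have fi := in12 i (or_introl erefl); have fm := in12 _ (or_intror erefl).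
  have fne : f i != f (m + i) by rewrite eq_f; lia.
  have one v : (t1 :&: t2)%SET = [set v]%SET -> False.
    by move=> e; move: fi fm fne; rewrite e !in_set1 => /eqP-> /eqP->; rewrite eqxx.
  have none : (t1 :&: t2)%SET = set0 -> False.
    by move=> e; move: fi; rewrite e in_set0.
  case: Xc cfg => [->|[->|->]] /=.
  - by case=> v [s [/one]].
  - by case=> v [s [/one]].
  - by case=> /none.
have x1 : f i \in t1 by rewrite E1; lia.
have x1' : f (m + i) \in t1 by rewrite E1; lia.
have x2 : f i \notin t2 by rewrite E2; lia.
have x2' : f (m + i) \notin t2 by rewrite E2; lia.
have y1 : f i' \notin t1 by rewrite E1; lia.
have y1' : f (m + i') \notin t1 by rewrite E1; lia.
have y2 : f i' \in t2 by rewrite E2; lia.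
have y2' : f (m + i') \in t2 by rewrite E2; lia.
have xx : f i != f (m + i) by rewrite eq_f; lia.
have yy : f i' != f (m + i') by rewrite eq_f; lia.
have mn2 : (2 * m <= n)%N by lia.
(* With distinct chords all four endpoints are private, and the chords cross; a split word for
   either triangle would put both ends of one chord on the same side of the other. *)
have sides s : ccw_listing (map val s) ->
    f i \in s -> f (m + i) \in s -> f i' \in s -> f (m + i') \in s ->
    split_word (labels t1 s) \/ split_word (labels t2 s) -> False.
  move=> ccw xs xs' ys ys' [sw|sw].
    have := split_word_same_side ccw sw xs xs' ys ys' x1 x1' y1 y1' xx.
    by rewrite ltNge ltW // crossing_chords.
  have := split_word_same_side ccw sw ys ys' xs xs' y2 y2' x2 x2' yy.
  by rewrite ltNge ltW // crossing_chords // eq_sym.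
have inU : [/\ f i \in t1 :|: t2, f (m + i) \in t1 :|: t2,
    f i' \in t1 :|: t2 & f (m + i') \in t1 :|: t2]%SET.
  by rewrite !in_setU x1 x1' y2 y2' !orbT.
(* Dropping the shared vertex [v] from the reading keeps the counterclockwise order and all private
   vertices. *)
have shared w : split_word w -> share_one w t1 t2 -> False.
  move=> sw [v [s [e [mem_s ccw] lab]]].
  have : v \in (t1 :&: t2)%SET by rewrite e set11.
  rewrite in_setI => /andP[v1 v2].
  have tail z : z \in (t1 :|: t2)%SET -> (z \notin t1) || (z \notin t2) -> z \in s.
    rewrite -mem_s in_cons => /orP[/eqP->|//]; by rewrite v1 v2.
  have [i1 i2 i3 i4] := inU.
  apply: (sides s).
  - case: ccw => /= /andP[_ us] ccw; split=> // k1 k2 k3 k123 k3s.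
    by have := ccw k1.+1 k2.+1 k3.+1 k123 k3s.
  - by apply: tail; rewrite // x2 orbT.
  - by apply: tail; rewrite // x2' orbT.
  - by apply: tail; rewrite // y1.
  - by apply: tail; rewrite // y1'.
  - by case: lab => ->; [left | right].
case: Xc cfg => [->|[->|->]] /=.
- exact: shared.
- exact: shared.
- case=> _ [s [[mem_s ccw] /split_word_rot sw]].
  by case: inU; rewrite -!mem_s => i1 i2 i3 i4; apply: (sides s) => //; left.
Qed.

End CcwEnumeration.

(** * Combination of the two bounds *)

Theorem theorem21 (R : realType) :
  exists (c C : R) (N : nat),
    [/\ 0 < c, 0 < C &
        forall (n : nat) (P : {fset R * R}),
          (N <= n)%N -> #|` P| = n -> convex_position P ->
          c * n%:R ^+ 2 <= (ex_triangles P bat_nested_ears)%:R <= C * n%:R ^+ 2].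
Proof.
(* For [n >= 3] one has [n <= 5 * (n %/ 3)], with equality at [n = 5]; squaring gives the factor
   25. *)
exists (25%:R^-1), 2%:R, 3%N; split; rewrite ?invr_gt0 ?ltr0n //.
move=> n P n3 Pn cP.
have /card_gt0P[x0 _] : (0 < #|{: P}|)%N by rewrite -cardfE Pn; lia.
have [f [f_inj f_surj f_ccw]] := convex_position_ccw_enum x0 cP.
rewrite -!natrX -natrM ler_nat mulrC ler_pdivrMr ?ltr0n // -natrM ler_nat.
apply/andP; split.
- have m3 : (3 * (n %/ 3) <= #|` P|)%N by rewrite Pn; lia.
  have av := chord_family_avoiding f_inj f_ccw m3.
  have le : (#|chord_family f (n %/ 3)| <= ex_triangles P bat_nested_ears)%N.
    by apply: (leq_bigmax_cond (F := fun F : {set {set P}} => #|F|)); apply/asboolP.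
  rewrite (card_chord_family f_inj) // in le.
  have : (n <= 5 * (n %/ 3))%N by lia.
  by rewrite -(leq_exp2r _ _ (isT : 0 < 2)%N) expnMn; lia.
- apply/bigmax_leqP => F /asboolP av.
  by rewrite -Pn; apply: avoiding_upper f_inj f_surj f_ccw _ av.
Qed.
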